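(* Let $V$ be a support sublinear Probability Vector Field on $\mathcal{P}(\mathbb{R}^n)$, let $T>0$ and let $\gamma$ be a Dirac germ for $V$. Then there exists at most one Lipschitz semigroup $S:[0,T]\times\mathcal{P}_c(\mathbb{R}^n)\to\mathcal{P}_c(\mathbb{R}^n)$ for $\dot\mu=V[\mu]$ compatible with $\gamma$.
   Context: $T\mathbb{R}^n=\mathbb{R}^n\times\mathbb{R}^n$ with points $(x,v)$, $\pi_1(x,v)=x$. $\mathcal{P}(X)$: Borel probability measures; $\mathcal{P}_c(X)$: those with compact support. $W$ is the 1-Wasserstein metric on $\mathbb{R}^n$. $B(0,R)$ is the ball of radius $R$ centered at $0$. A Probability Vector Field (PVF) is a map $V:\mathcal{P}(\mathbb{R}^n)\to\mathcal{P}(T\mathbb{R}^n)$ with $\pi_1\#V[\mu]=\mu$. It is support sublinear with constant $C>0$ if for every $\mu\in\mathcal{P}_c(\mathbb{R}^n)$: $\sup_{(x,v)\in \mathrm{Supp}(V[\mu])}|v|\le C(1+\sup_{x\in \mathrm{Supp}(\mu)}|x|)$. Solution: a curve $\mu$ defined on an interval $[0,\tau]$ with values in $\mathcal{P}(\mathbb{R}^n)$ is a solution to $\dot\mu=V[\mu]$ if for every $f\in C_c^\infty(\mathbb{R}^n)$: $\int_{T\mathbb{R}^n}\nabla f(x)\cdot v\,dV[\mu(s)](x,v)$ is defined for a.e. $s$ and is $L^1$ in $s\in[0,\tau]$, $t\mapsto\int f\,d\mu(t)$ is absolutely continuous, and for a.e. $t$, $\frac{d}{dt}\int f\,d\mu(t)=\int_{T\mathbb{R}^n}\nabla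 f(x)\cdot v\,dV[\mu(t)](x,v)$. Lipschitz semigroup for $\dot\mu=V[\mu]$: a map $S:[0,T]\times\mathcal{P}_c(\mathbb{R}^n)\to\mathcal{P}_c(\mathbb{R}^n)$ such that for all $\mu,\nu\in\mathcal{P}_c(\mathbb{R}^n)$ and $t,s\in[0,T]$: (i) $S_0\mu=\mu$ and $S_tS_s\mu=S_{t+s}\mu$ (when $t+s\le T$); (ii) $t\mapsto S_t\mu$ is a solution to $\dot\mu=V[\mu]$; (iii) for every $R>0$ there is $C(R)>0$ such that if $\mathrm{Supp}(\mu),\mathrm{Supp}(\nu)\subset B(0,R)$ then $\mathrm{Supp}(S_t\mu)\subset B(0,e^{Ct}(R+1))$ (with $C$ the support-sublinearity constant), $W(S_t\mu,S_t\nu)\le e^{C(R)t}W(\mu,\nu)$, and $W(S_t\mu,S_s\mu)\le C(R)|t-s|$. Let $\mathcal{D}=\{\sum_{i=1}^N m_i\delta_{x_i}: N\in\mathbb{N},\ m_i>0,\ \sum_i m_i=1,\ x_i\in\mathbb{R}^n\}$ and $\mathcal{D}_R=\{\mu\in\mathcal{D}:\mathrm{Supp}(\mu)\subset B(0,R)\}$. A Dirac germ $\gamma$ assigns to every $\mu\in\mathcal{D}$ a Lipschitz curve (for $W$) $\gamma_\mu:[0,\epsilon(\mu)]\to\mathcal{P}_c(\mathbb{R}^n)$ with $\gamma_\mu(0)=\mu$, which is a solution to $\dot\mu=V[\mu]$, where $\epsilon(\mu)>0$ and $\inf_{\mu\in\mathcal{D}_R}\epsilon(\mu)>0$ for every $R>0$.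 A Lipschitz semigroup $S$ is compatible with $\gamma$ if for every $R>0$ there exists $C'(R)>0$ such that for every $t\in[0,\inf_{\mu\in\mathcal{D}_R}\epsilon(\mu)]$ (with $t\le T$), $\sup_{\mu\in\mathcal{D}_R}W(S_t\mu,\gamma_\mu(t))\le C'(R)\,t^2$. *)

(* Defs.v *)
From HB Require Import structures.
From mathcomp Require Import all_boot all_order all_algebra.
From mathcomp Require Import all_classical all_reals all_analysis.
From mathcomp Require Import giry.

Set Implicit Arguments.
Unset Strict Implicit.
Unset Printing Implicit Defensive.

Import Order.TTheory GRing.Theory Num.Theory.
Import numFieldNormedType.Exports.

Local Open Scope classical_set_scope.
Local Open Scope ring_scope.

(* A [probability] is a function on all sets, whose values on non-Borel sets
   carry no meaning. Two elements of P(X) are the same Borel measure when they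
   are related by [measure_eq] (notation mu ≡μ nu), so every map defined on
   measures below is required to respect this relation. *)
Notation borel X := (g_sigma_algebraType (@open X)).

HB.instance Definition _ (X Y : ptopologicalType) := Pointed.on (X * Y)%type.

Definition Prob (R : realType) (X : ptopologicalType) : Type :=
  probability (borel X) R.

Definition supp (R : realType) (X : ptopologicalType) (mu : Prob R X) : set X :=
  [set x | forall U : set X, open U -> U x -> (0 < mu U)%E].

Definition Pc (R : realType) (X : ptopologicalType) : set (Prob R X) :=
  [set mu | compact (supp mu)].

Section MeasureDifferentialEquations.
Variables (R : realType) (n : nat).

Local Notation E := 'rV[R]_n.
Local Notation TE := ('rV[R]_n * 'rV[R]_n)%type.

Definition dotp (u v : E) : R := \sum_(i < n) u ord0 i * v ord0 i.

(* The library norm on 'rV[R]_n is the sup norm; |x| is the Euclidean one. *)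
Definition enorm (x : E) : R := Num.sqrt (dotp x x).

Definition eball (r : R) : set E := [set x | enorm x < r].

Definition coupling (mu nu : Prob R E) : set (Prob R TE) :=
  [set tau | forall A : set (borel E), measurable A ->
     pushforward tau (fst : borel TE -> borel E) A = mu A /\
     pushforward tau (snd : borel TE -> borel E) A = nu A].

(* Kantorovich formulation of the 1-Wasserstein distance. *)
Definition W (mu nu : Prob R E) : \bar R :=
  ereal_inf [set (\int[tau]_z (enorm (z.1 - z.2))%:E)%E | tau in coupling mu nu].

Record is_pvf (V : Prob R E -> Prob R TE) : Prop := {
  pvf_ext : forall mu nu : Prob R E, mu ≡μ nu -> V mu ≡μ V nu ;
  pvf_marginal : forall (mu : Prob R E) (A : set (borel E)), measurable A ->
    pushforward (V mu) (fst : borel TE -> borel E) A = mu A }.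

(* The suprema are taken in \bar R: the support of V mu is not assumed bounded. *)
Definition support_sublinear (C : R) (V : Prob R E -> Prob R TE) : Prop :=
  forall mu : Prob R E, Pc mu ->
    (ereal_sup [set (enorm z.2)%:E | z in supp (V mu)] <=
     C%:E * (1 + ereal_sup [set (enorm x)%:E | x in supp mu]))%E.

Definition partial (i : 'I_n) (f : E -> R) : E -> R :=
  fun x => 'D_(delta_mx ord0 i) f x.

Definition grad (f : E -> R) (x : E) : E := \row_(i < n) partial i f x.

Fixpoint Ck (k : nat) (f : E -> R) : Prop :=
  continuous f /\
  if k is k'.+1 then
    forall i : 'I_n,
      (forall x : E, derivable f x (delta_mx ord0 i)) /\ Ck k' (partial i f)
  else True.

Definition Cc_infty (f : E -> R) : Prop :=
  (forall k, Ck k f) /\ compact (closure [set x | f x != 0]).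

Definition abs_continuous (a b : R) (F : R -> R) : Prop :=
  forall e : R, 0 < e -> exists2 d : R, 0 < d &
    forall (N : nat) (u v : 'I_N -> R),
      (forall i, [/\ a <= u i, u i <= v i & v i <= b]) ->
      trivIset setT (fun i => `]u i, v i[%classic) ->
      \sum_(i < N) (v i - u i) < d ->
      \sum_(i < N) `|F (v i) - F (u i)| < e.

(* Integrand of the right-hand side of the equation tested against f. *)
Definition transport (f : E -> R) (z : TE) : R := dotp (grad f z.1) z.2.

(* Only the values of mu on [0, tau] matter. The function
   s |-> \int[V (mu s)] transport f is only defined almost everywhere; it is in
   L^1(0, tau) when it agrees a.e. with a Borel integrable function g. *)
Definition is_solution (V : Prob R E -> Prob R TE) (tau : R)
    (mu : R -> Prob R E) : Prop :=
  forall f : E -> R, Cc_infty f ->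
    let F := fun t : R => \int[mu t]_x f x in
    [/\ exists g : R -> R,
          lebesgue_measure.-integrable `[0, tau] (EFin \o g) /\
          {ae lebesgue_measure, forall s : R, s \in `[0, tau] ->
            (V (mu s)).-integrable setT (EFin \o transport f) /\
            \int[V (mu s)]_z transport f z = g s},
        abs_continuous 0 tau F &
        {ae lebesgue_measure, forall t : R, t \in `]0, tau[ ->
          derivable F t 1 /\ (F^`())%classic t = \int[V (mu t)]_z transport f z}].

(* C is the support-sublinearity constant of V. *)
Record lipschitz_semigroup (V : Prob R E -> Prob R TE) (C T : R)
    (S : R -> Prob R E -> Prob R E) : Prop := {
  sg_ext : forall (t : R) (mu nu : Prob R E), 0 <= t <= T -> Pc mu -> Pc nu ->
    mu ≡μ nu -> S t mu ≡μ S t nu ;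
  sg_Pc : forall (t : R) (mu : Prob R E), 0 <= t <= T -> Pc mu -> Pc (S t mu) ;
  sg_0 : forall mu : Prob R E, Pc mu -> S 0 mu ≡μ mu ;
  sg_D : forall (t s : R) (mu : Prob R E),
    0 <= t <= T -> 0 <= s <= T -> t + s <= T -> Pc mu ->
    S t (S s mu) ≡μ S (t + s) mu ;
  sg_sol : forall mu : Prob R E, Pc mu -> is_solution V T (fun t => S t mu) ;
  sg_lip : forall r : R, 0 < r -> exists2 Cr : R, 0 < Cr &
    forall mu nu : Prob R E, Pc mu -> Pc nu ->
      supp mu `<=` eball r -> supp nu `<=` eball r ->
      forall t s : R, 0 <= t <= T -> 0 <= s <= T ->
        [/\ supp (S t mu) `<=` eball (expR (C * t) * (r + 1)),
            (W (S t mu) (S t nu) <= (expR (Cr * t))%:E * W mu nu)%E &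
            (W (S t mu) (S s mu) <= (Cr * `|t - s|)%:E)%E] }.

Definition discrete_prob : set (Prob R E) :=
  [set mu : Prob R E | exists (N : nat) (m : 'I_N -> R) (x : 'I_N -> borel E),
    [/\ forall i, 0 < m i,
        \sum_(i < N) m i = 1 &
        forall A : set (borel E), measurable A ->
          mu A = (\sum_(i < N) (m i)%:E * \d_(x i) A)%E]].

Definition discrete_prob_in (r : R) : set (Prob R E) :=
  [set mu : Prob R E | discrete_prob mu /\ supp mu `<=` eball r].

(* The curve gamma mu is only meaningful on [0, eps mu], for mu in D. *)
Record dirac_germ (V : Prob R E -> Prob R TE) (eps : Prob R E -> R)
    (gamma : Prob R E -> R -> Prob R E) : Prop := {
  germ_ext_eps : forall mu nu : Prob R E, discrete_prob mu -> discrete_prob nu ->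
    mu ≡μ nu -> eps mu = eps nu ;
  germ_ext : forall (mu nu : Prob R E) (t : R), discrete_prob mu -> discrete_prob nu ->
    mu ≡μ nu -> 0 <= t <= eps mu -> gamma mu t ≡μ gamma nu t ;
  germ_eps : forall mu : Prob R E, discrete_prob mu -> 0 < eps mu ;
  germ_inf : forall r : R, 0 < r -> 0 < inf [set eps mu | mu in discrete_prob_in r] ;
  germ_Pc : forall (mu : Prob R E) (t : R),
    discrete_prob mu -> 0 <= t <= eps mu -> Pc (gamma mu t) ;
  germ_lip : forall mu : Prob R E, discrete_prob mu -> exists L : R,
    forall t s : R, 0 <= t <= eps mu -> 0 <= s <= eps mu ->
      (W (gamma mu t) (gamma mu s) <= (L * `|t - s|)%:E)%E ;
  germ_0 : forall mu : Prob R E, discrete_prob mu -> gamma mu 0 ≡μ mu ;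
  germ_sol : forall mu : Prob R E, discrete_prob mu -> is_solution V (eps mu) (gamma mu) }.

Definition compatible (T : R) (S : R -> Prob R E -> Prob R E)
    (eps : Prob R E -> R) (gamma : Prob R E -> R -> Prob R E) : Prop :=
  forall r : R, 0 < r -> exists2 C' : R, 0 < C' &
    forall t : R, 0 <= t <= inf [set eps mu | mu in discrete_prob_in r] -> t <= T ->
      (ereal_sup [set W (S t mu) (gamma mu t) | mu in discrete_prob_in r] <=
       (C' * t ^+ 2)%:E)%E.

End MeasureDifferentialEquations.

(* Main.v *)
(* Fix a nonnegative Lipschitz function f and write I(m) for its integral. Cut
   [0, t] into N steps of length h and telescope I along the measures
   S1_(t - jh) S2_(jh) mu. Consecutive terms differ by applying S1_s to S1_h nu
   and to S2_h nu. Replacing nu by a discrete measure at distance h^2 and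
   comparing both with the germ, every link costs O(h^2) in W, hence O(h^2) in I
   after applying S1_s. The sum is O(1/N), so I(S1_t mu) = I(S2_t mu), and
   Lipschitz functions separate Borel measures. Since only I is added along the
   chain, the triangle inequality for W is not needed. *)
Require Import Defs.
From mathcomp Require Import all_boot all_order all_algebra.
From mathcomp Require Import all_classical all_reals all_analysis.
From mathcomp Require Import giry measurable_realfun.
From mathcomp Require Import finmap lra ring.

Set Implicit Arguments.
Unset Strict Implicit.
Unset Printing Implicit Defensive.

Import Order.TTheory GRing.Theory Num.Theory.
Import numFieldNormedType.Exports.

Local Open Scope classical_set_scope.
Local Open Scope ring_scope.

(** * The Euclidean norm and its relation to the topology of row vectors *)

Section EuclideanNorm.
Context {R : realType} {n : nat}.
Local Notation E := 'rV[R]_n.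
Implicit Types (u v x y : E) (a : R).

Lemma dotpC u v : dotp u v = dotp v u.
Proof. by apply: eq_bigr => i _; rewrite mulrC. Qed.

Lemma dotpDl u v x : dotp (u + v) x = dotp u x + dotp v x.
Proof.
by rewrite /dotp -big_split; apply: eq_bigr => i _; rewrite !mxE mulrDl.
Qed.

Lemma dotpZl a u v : dotp (a *: u) v = a * dotp u v.
Proof. by rewrite /dotp mulr_sumr; apply: eq_bigr => i _; rewrite !mxE mulrA. Qed.

Lemma dotpDr u v x : dotp u (v + x) = dotp u v + dotp u x.
Proof. by rewrite dotpC dotpDl !(dotpC u). Qed.

Lemma dotpZr a u v : dotp u (a *: v) = a * dotp u v.
Proof. by rewrite dotpC dotpZl dotpC. Qed.

Lemma dotp_ge0 u : 0 <= dotp u u.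
Proof. by apply: sumr_ge0 => i _; rewrite -expr2 sqr_ge0. Qed.

Lemma enorm_ge0 u : 0 <= enorm u. Proof. exact: sqrtr_ge0. Qed.

Lemma sqr_enorm u : enorm u ^+ 2 = dotp u u.
Proof. by rewrite sqr_sqrtr// dotp_ge0. Qed.

Lemma enorm0 : enorm (0 : E) = 0.
Proof. by rewrite /enorm /dotp big1 ?sqrtr0// => i _; rewrite mxE mul0r. Qed.

Lemma enormZ a u : enorm (a *: u) = `|a| * enorm u.
Proof.
by rewrite /enorm dotpZl dotpZr mulrA -expr2 sqrtrM ?sqr_ge0// sqrtr_sqr.
Qed.

Lemma enormN u : enorm (- u) = enorm u.
Proof. by rewrite -scaleN1r enormZ normrN1 mul1r. Qed.

Lemma enormB u v : enorm (u - v) = enorm (v - u).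
Proof. by rewrite -enormN opprB. Qed.

(** Cauchy-Schwarz. For v nonzero, expand the nonnegative square norm of |v|^2 u - <u,v> v and
    divide by |v|^2; a negative <u,v> is handled separately so that squares can be compared. *)
Lemma dotp_le_enorm u v : dotp u v <= enorm u * enorm v.
Proof.
have [v0|v0] := eqVneq (enorm v) 0.
  have vi i : v ord0 i = 0.
    have : dotp v v = 0 by rewrite -sqr_enorm v0 expr0n.
    move/eqP; rewrite psumr_eq0; last by move=> j _; rewrite -expr2 sqr_ge0.
    by move/allP => /(_ i); rewrite mem_index_enum -expr2 sqrf_eq0 => /(_ isT)/eqP.
  by rewrite v0 mulr0 /dotp big1// => i _; rewrite vi mulr0.
have vp : 0 < enorm v by rewrite lt_neqAle eq_sym v0 enorm_ge0.
have [u0|u0] := ltP (dotp u v) 0.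
  by rewrite (le_trans (ltW u0))// mulr_ge0// enorm_ge0.
rewrite -ler_sqr ?nnegrE ?mulr_ge0 ?enorm_ge0//.
have := dotp_ge0 (enorm v ^+ 2 *: u + (- dotp u v) *: v).
rewrite !(dotpDl, dotpDr, dotpZl, dotpZr) exprMn (dotpC v u) -!sqr_enorm.
set a := enorm v; set b := enorm u; set c := dotp u v => H.
have {}H : 0 <= a ^+ 2 * (b ^+ 2 * a ^+ 2 - c ^+ 2).
  by apply: le_trans H _; rewrite le_eqVlt; apply/orP; left; apply/eqP; ring.
by rewrite -subr_ge0 -(pmulr_rge0 _ (_ : 0 < a ^+ 2))// exprn_gt0.
Qed.

Lemma enormD u v : enorm (u + v) <= enorm u + enorm v.
Proof.
rewrite -ler_sqr ?nnegrE ?addr_ge0 ?enorm_ge0// sqrrD !sqr_enorm.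
rewrite dotpDl !dotpDr (dotpC v u).
have := dotp_le_enorm u v; lra.
Qed.

Lemma enorm_distD x u v : enorm (u - v) <= enorm (u - x) + enorm (x - v).
Proof. by rewrite (le_trans _ (enormD _ _))// addrA subrK. Qed.

(** The topology comes from the sup norm; this inequality lets Euclidean estimates yield
    neighbourhoods and boundedness in that topology. *)
Lemma le_norm_enorm x : `|x| <= enorm x.
Proof.
rewrite [leLHS]mx_normrE; apply: bigmax_le; first exact: enorm_ge0.
move=> [i j] _ /=; rewrite (ord1 i) -ler_sqr ?nnegrE ?enorm_ge0//.
rewrite sqr_enorm real_normK ?num_real// /dotp (bigD1 j)//= -expr2 lerDl.
by apply: sumr_ge0 => k _; rewrite -expr2 sqr_ge0.
Qed.

Lemma enorm_continuous : continuous (@enorm R n).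
Proof.
move=> x; apply: continuous_comp; last exact: sqrt_continuous.
apply: (continuous_big (op := +%R)) => [|i _ y]; first exact: add_continuous.
have ci := @coord_continuous R 1 n ord0 i y.
exact: (continuousM ci ci).
Qed.

Lemma ball_enorm (U : set E) x : open U -> U x ->
  exists2 e : R, 0 < e & forall y, enorm (x - y) < e -> U y.
Proof.
move=> oU Ux; have /nbhs_ballP[e /= e0 eU] : nbhs x U by exact: open_nbhs_nbhs.
exists e => // y xy; apply: eU; rewrite -ball_normE /=.
exact: le_lt_trans (le_norm_enorm _) xy.
Qed.

Lemma lipschitz_enorm_continuous (f : E -> R) (c : R) :
  (forall x y, f x <= f y + c * enorm (x - y)) -> continuous f.
Proof.
move=> fc x.
have fxy y : `|f x - f y| <= c * enorm (x - y).
  rewrite ler_norml; apply/andP; split; last by have := fc x y; lra.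
  by have := fc y x; rewrite enormB; lra.
have cx : {for x, continuous (fun y => c * enorm (x - y))}.
  apply: continuousM; first exact: cst_continuous.
  apply: (@continuous_comp _ _ _ (fun y : E => x - y)); last exact: enorm_continuous.
  by apply: continuousB; [exact: cst_continuous|exact: cvg_id].
have FF : Filter (nbhs x) := nbhs_filter x.
apply/(@cvgrPdist_le _ _ _ (nbhs x) FF) => e e0.
move/(@cvgrPdist_le _ _ _ (nbhs x) FF) : cx => /(_ e e0).
rewrite subrr enorm0 mulr0; apply: filterS => y; rewrite sub0r normrN => /(le_trans (ler_norm _)).
exact/le_trans.
Qed.

End EuclideanNorm.

(** * Borel measurability and image measures *)

Section BorelMaps.
Context {X Y : ptopologicalType}.

Lemma open_borel (U : set X) : open U -> measurable (U : set (borel X)).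
Proof. exact: sub_sigma_algebra. Qed.

Lemma closed_borel (F : set X) : closed F -> measurable (F : set (borel X)).
Proof.
by rewrite -openC => /open_borel/measurableC; rewrite setCK.
Qed.

Lemma borel_measurable_fun (f : X -> Y) :
  (forall U : set Y, open U -> measurable (f @^-1` U : set (borel X))) ->
  measurable_fun setT (f : borel X -> borel Y).
Proof.
move=> fU; apply: (@measurability _ _ (borel X) (borel Y) _ _ (@open Y)) => // _ [U oU <-].
by rewrite setTI; exact: fU.
Qed.

Lemma continuous_borel_measurable (f : X -> Y) :
  continuous f -> measurable_fun setT (f : borel X -> borel Y).
Proof.
move=> /continuousP cf; apply: borel_measurable_fun => U /cf; exact: open_borel.
Qed.

Lemma continuous_real_measurable (R : realType) (f : X -> R) :
  continuous f -> measurable_fun setT (f : borel X -> R).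
Proof.
move=> /continuousP cf; apply: (@measurability _ _ (borel X) R _ _ (@RGenOpens.G R)).
  exact: RGenOpens.measurableE.
move=> _ [_ [x [y ->]] <-]; rewrite setTI; apply: open_borel; apply: cf.
exact: interval_open.
Qed.

Lemma image_prob (R : realType) (mu : Prob R X) (f : X -> Y) :
  measurable_fun setT (f : borel X -> borel Y) ->
  exists nu : Prob R Y, forall A, nu A = mu (f @^-1` A).
Proof.
move=> mf.
pose F : {mfun borel X >-> borel Y} := mfun_Sub (mem_set mf).
by exists (distribution mu F).
Qed.

End BorelMaps.

(** Change of variables. The image law is assumed on Borel sets only, which is how a coupling
    provides its marginals. *)
Lemma ge0_integral_image (R : realType) (X Y : ptopologicalType) (mu : Prob R X)
    (nu : Prob R Y) (f : X -> Y) (g : Y -> \bar R) :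
  measurable_fun setT (f : borel X -> borel Y) ->
  measurable_fun setT (g : borel Y -> \bar R) -> (forall y, 0 <= g y)%E ->
  (forall A : set (borel Y), measurable A -> nu A = mu (f @^-1` A)) ->
  (\int[nu]_y g y = \int[mu]_x g (f x))%E.
Proof.
move=> mf mg g0 nuE.
rewrite (eq_measure_integral (pushforward mu (f : borel X -> borel Y))).
  by rewrite ge0_integral_pushforward.
by move=> A mA _; exact: nuE.
Qed.

(** * Lipschitz cutoff functions of open sets *)

Section Cutoff.
Context {R : realType} {n : nat}.
Local Notation E := 'rV[R]_n.
Implicit Types (U : set E) (k : R) (x y : E).

(* min (1, k * dist (x, ~` U)), with the distance to the empty set infinite. *)
Definition cutoff U k x : R :=
  inf ([set 1] `|` [set k * enorm (x - y) | y in ~` U]).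

Lemma cutoff_nonempty U k x :
  ([set 1] `|` [set k * enorm (x - y) | y in ~` U]) !=set0.
Proof. by exists 1; left. Qed.

Lemma le_cutoff U k x (c : R) : c <= 1 ->
  (forall y, ~ U y -> c <= k * enorm (x - y)) -> c <= cutoff U k x.
Proof.
move=> c1 cU; apply: lb_le_inf; first exact: cutoff_nonempty.
by move=> _ [->//|[y Uy <-]]; exact: cU.
Qed.

Section fixed_slope.
Variables (U : set E) (k : R).
Hypothesis k0 : 0 <= k.

Lemma cutoff_has_lbound x :
  has_lbound ([set 1] `|` [set k * enorm (x - y) | y in ~` U]).
Proof.
exists 0 => _ [->|[y _ <-]]; first exact: ler01.
by rewrite mulr_ge0// enorm_ge0.
Qed.

Lemma cutoff_ge0 x : 0 <= cutoff U k x.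
Proof. by apply: le_cutoff => // y _; rewrite mulr_ge0// enorm_ge0. Qed.

Lemma cutoff_le1 x : cutoff U k x <= 1.
Proof. by apply: ge_inf; [exact: cutoff_has_lbound|left]. Qed.

Lemma cutoff_le x y : ~ U y -> cutoff U k x <= k * enorm (x - y).
Proof. by move=> Uy; apply: ge_inf; [exact: cutoff_has_lbound|right; exists y]. Qed.

Lemma cutoff_lipschitz x y : cutoff U k x <= cutoff U k y + k * enorm (x - y).
Proof.
rewrite -lerBlDr; apply: le_cutoff => [|z Uz].
  by rewrite lerBlDr (le_trans (cutoff_le1 x))// lerDl mulr_ge0// enorm_ge0.
rewrite lerBlDr (le_trans (cutoff_le _ Uz))// -mulrDr ler_wpM2l//.
by rewrite [leRHS]addrC enorm_distD.
Qed.

Lemma cutoff_continuous : continuous (cutoff U k).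
Proof. exact: lipschitz_enorm_continuous cutoff_lipschitz. Qed.

Lemma cutoff_notin x : ~ U x -> cutoff U k x = 0.
Proof.
move=> Ux; apply/eqP; rewrite eq_le cutoff_ge0 andbT.
by rewrite (le_trans (cutoff_le x Ux))// subrr enorm0 mulr0.
Qed.

End fixed_slope.

Lemma cutoff_nondecreasing U k k' x : 0 <= k -> k <= k' ->
  cutoff U k x <= cutoff U k' x.
Proof.
move=> k0 kk; apply: le_cutoff; first exact: cutoff_le1.
by move=> y Uy; rewrite (le_trans (cutoff_le k0 x Uy))// ler_wpM2r// enorm_ge0.
Qed.

(** If the Euclidean ball of radius e around x lies in U, every y outside U has |x - y| >= e, so any
    slope k >= 1/e gives k|x - y| >= 1. *)
Lemma cutoff_eq1 U x : open U -> U x ->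
  exists k0 : nat, forall k : nat, (k0 <= k)%N -> cutoff U k%:R x = 1.
Proof.
move=> oU Ux; have [e e0 eU] := ball_enorm oU Ux.
have /archi_boundP : 0 <= e^-1 by rewrite invr_ge0 ltW.
set k0 := Num.bound _ => k0e; exists k0 => k kk.
apply/eqP; rewrite eq_le cutoff_le1//=; apply: le_cutoff => // y Uy.
have ey : e <= enorm (x - y) by rewrite leNgt; apply/negP => /eU.
rewrite (@le_trans _ _ (k%:R * e))//; last by rewrite ler_wpM2l.
rewrite -ler_pdivrMr// mul1r (le_trans (ltW k0e))// ler_nat//.
Qed.

End Cutoff.

(** * Separation of measures by Lipschitz functions, and supports *)

Section MeasureSupport.
Context {R : realType} {n : nat}.
Local Notation E := 'rV[R]_n.
Implicit Types (mu nu : Prob R E).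

(* The cutoff functions of an open set increase to its indicator. *)
Lemma eq_lipschitz_integral mu nu :
  (forall (f : E -> R) (k : R), 0 <= k -> (forall x, 0 <= f x) ->
     (forall x y, f x <= f y + k * enorm (x - y)) ->
     (\int[mu]_x (f x)%:E = \int[nu]_x (f x)%:E)%E) ->
  mu ≡μ nu.
Proof.
move=> H.
have open_eq U : open U -> mu U = nu U.
  move=> oU; pose g (k : nat) (x : borel E) := (cutoff U k%:R x)%:E.
  have limg x : limn (g ^~ x) = (\1_U x)%:E.
    apply/cvg_lim => //; have [Ux|Ux] := pselect (U x).
      have [k0 k0P] := cutoff_eq1 oU Ux.
      apply: (@cvg_near_cst _ _ _ _ _ _ _).
      by exists k0 => // k /= /k0P; rewrite /g => ->; rewrite indicE mem_set.
    apply: cvg_near_cst; exists 0%N => // k _; rewrite /g cutoff_notin//.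
    by rewrite indicE memNset.
  have cvgg (la : Prob R E) : (\int[la]_x g k x @[k --> \oo] --> la U)%E.
    have -> : la U = (\int[la]_x limn (g ^~ x))%E.
      under eq_integral do rewrite limg.
      by rewrite integral_indic// ?setIT//; exact: open_borel.
    apply: cvg_monotone_convergence => //.
    - move=> k; apply/measurable_EFinP; apply: continuous_real_measurable.
      exact: cutoff_continuous.
    - by move=> k x _; rewrite lee_fin cutoff_ge0.
    - by move=> x _ a b ab; rewrite lee_fin cutoff_nondecreasing// ler_nat.
  apply: (cvg_unique _ (cvgg mu)) => //.
  have -> : (fun k => \int[mu]_x g k x)%E = (fun k => \int[nu]_x g k x)%E.
    apply/funext => k; by apply: (H _ k%:R) => // x; [exact: cutoff_ge0|exact: cutoff_lipschitz].
  exact: cvgg.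
(* Open sets form a generating class closed under intersection and containing the whole space, so
   agreement on them extends to all Borel sets. *)
move=> A mA; apply: (@measure_unique _ R (borel E) (@open E) (fun=> setT)) => //.
- by move=> U V; exact: openI.
- by move=> _; exact: openT.
- by rewrite bigcup_const//; exists 0%N.
- by move=> _; rewrite (le_lt_trans (probability_le1 mu measurableT))// ltry.
Qed.

Lemma supp_setC mu : ~` supp mu = \bigcup_(U in [set U | open U /\ mu U = 0%E]) U.
Proof.
apply/seteqP; split => [x /existsNP[U /not_implyP[oU /not_implyP[Ux]]]|x [U [oU mU0] Ux] sx].
  move=> /negP; rewrite -leNgt => mU; exists U => //; split => //.
  by apply/eqP; rewrite eq_le mU measure_ge0.
by have := sx U oU Ux; rewrite mU0 ltxx.
Qed.

Lemma supp_closed mu : closed (supp mu).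
Proof.
by rewrite -openC supp_setC; apply: bigcup_open => U [].
Qed.

Lemma bounded_closed_compact_enorm (A : set E) (r : R) :
  closed A -> (forall x, A x -> enorm x <= r) -> compact A.
Proof.
move=> cA Ar; apply: bounded_closed_compact => //.
exists r; split; first exact: num_real.
move=> s rs x /Ar xr; exact: le_trans (le_norm_enorm x) (le_trans xr (ltW rs)).
Qed.

Lemma compact_enorm_bounded (A : set E) : compact A ->
  exists2 r : R, 0 < r & A `<=` eball r.
Proof.
move=> cA; have : compact (@enorm R n @` A).
  by apply: continuous_compact cA; apply: continuous_subspaceT; exact: enorm_continuous.
move=> /compact_bounded[M [_ MA]].
(* The bound is available for numbers strictly above M, hence the first 1; the second makes the
   inequality strict, as [eball] is open. *)
exists (`|M| + 1 + 1) => [|x Ax].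
  by rewrite ltr_wpDl// addr_ge0.
have := MA (`|M| + 1); rewrite (le_lt_trans (ler_norm M)) ?ltrDl//.
move=> /(_ isT (enorm x)) /(_ (imageP _ Ax)) /=.
by rewrite ger0_norm ?enorm_ge0// => /le_lt_trans; apply; rewrite ltrDl.
Qed.

(** The complement of the support is a possibly uncountable union of null open sets. It is exhausted
    by countably many compact sets, each covered by finitely many of these null sets. *)
Lemma null_supp_setC mu : mu (~` supp mu) = 0%E.
Proof.
have oU : open (~` supp mu) by rewrite openC; exact: supp_closed.
(* Points of norm at most j whose cutoff of slope j has reached 1: a closed bounded set inside the
   open complement of the support. *)
pose K (j : nat) := [set x : E | enorm x <= j%:R /\ 1 <= cutoff (~` supp mu) j%:R x].
have Kc j : closed (K j).
  apply: closedI.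
    apply: (@preimage_closed _ _ (@enorm R n) [set y | y <= j%:R]).
      by move=> x _; exact: enorm_continuous.
    exact: closed_le.
  apply: (@preimage_closed _ _ (cutoff _ j%:R) [set y | 1 <= y]).
    by move=> x _; exact: cutoff_continuous.
  exact: closed_ge.
have Kcpt j : compact (K j).
  by apply: (@bounded_closed_compact_enorm _ j%:R) => // x [].
have -> : ~` supp mu = \bigcup_j K j.
  apply/seteqP; split=> [x Ux|x [j _ [_ Kx]] sx]; last first.
    by move: Kx; rewrite cutoff_notin ?ler10// => /(_ sx).
  have [k0 k0P] := cutoff_eq1 oU Ux.
  exists (maxn k0 (Num.bound (enorm x))) => //; split; last first.
    by rewrite k0P// leq_maxl.
  rewrite (le_trans (ltW (archi_boundP (enorm_ge0 x))))// ler_nat leq_maxr//.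
have KU j : K j `<=` ~` supp mu.
  by move=> x [_ Kx] sx; move: Kx; rewrite cutoff_notin ?ler10//.
apply/eqP; rewrite eq_le measure_ge0 andbT.
have mK j : measurable (K j : set (borel E)) by exact: closed_borel.
rewrite (le_trans (measure_sigma_subadditive _ mK _ (@subset_refl _ _)))//.
  exact: bigcupT_measurable.
rewrite eseries0// => j _ _.
have := Kcpt j; rewrite compact_cover.
move=> /(_ _ [set U | open U /\ mu U = 0%E] id) [].
- by move=> U [].
- by rewrite /cover -supp_setC.
move=> D DU KD; apply/eqP; rewrite eq_le measure_ge0 andbT.
have DU' U : U \in D -> open U /\ mu U = 0%E by move=> /DU/set_mem.
rewrite (le_trans (@content_sub_fsum _ _ _ mu _ [set` D] (K j) id _ _ _ KD))//.
  by move=> U /DU'[openU _]; exact: open_borel.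
by rewrite fsbig1// => U /DU'[].
Qed.

End MeasureSupport.

Section Wasserstein.
Context {R : realType} {n : nat}.
Local Notation E := 'rV[R]_n.
Local Notation TE := ('rV[R]_n * 'rV[R]_n)%type.
Implicit Types (mu nu : Prob R E).

Definition cost (tau : Prob R TE) : \bar R :=
  (\int[tau]_z (enorm (z.1 - z.2))%:E)%E.

Lemma fst_borel : measurable_fun setT (fst : borel TE -> borel E).
Proof. by apply: continuous_borel_measurable => z; exact: cvg_fst. Qed.

Lemma snd_borel : measurable_fun setT (snd : borel TE -> borel E).
Proof. by apply: continuous_borel_measurable => z; exact: cvg_snd. Qed.

Lemma dist_continuous : continuous (fun z : TE => enorm (z.1 - z.2)).
Proof.
move=> z; apply: (@continuous_comp _ _ _ (fun z : TE => z.1 - z.2)).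
  by apply: continuousB; [exact: cvg_fst|exact: cvg_snd].
exact: enorm_continuous.
Qed.

Lemma dist_measurable (k : R) :
  measurable_fun setT (fun z : borel TE => (k * enorm (z.1 - z.2))%:E).
Proof.
apply/measurable_EFinP; apply: measurable_funM => //.
by apply: continuous_real_measurable; exact: dist_continuous.
Qed.

Lemma dist_measurable1 :
  measurable_fun setT (fun z : borel TE => (enorm (z.1 - z.2))%:E).
Proof. by have := dist_measurable 1; under eq_fun do rewrite mul1r. Qed.

Lemma W_lt mu nu (w : \bar R) : (W mu nu < w)%E ->
  exists2 tau, coupling mu nu tau & (cost tau < w)%E.
Proof. by move=> /ereal_inf_lt[_ [tau ctau <-] tauw]; exists tau. Qed.

(** The easy half of Kantorovich duality: write both integrals over the coupling and integrate the
    pointwise Lipschitz bound. The two inequalities avoid subtracting integrals that may be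
    infinite. *)
Lemma coupling_lipschitz mu nu tau (f : E -> R) (k : R) :
  coupling mu nu tau -> 0 <= k -> (forall x, 0 <= f x) ->
  (forall x y, f x <= f y + k * enorm (x - y)) ->
  (\int[mu]_x (f x)%:E <= \int[nu]_x (f x)%:E + k%:E * cost tau)%E /\
  (\int[nu]_x (f x)%:E <= \int[mu]_x (f x)%:E + k%:E * cost tau)%E.
Proof.
move=> ctau k0 f0 fk.
have mf : measurable_fun setT (fun x : borel E => (f x)%:E).
  apply/measurable_EFinP; apply: continuous_real_measurable.
  exact: lipschitz_enorm_continuous fk.
have f0' x : (0 <= (f x)%:E)%E by rewrite lee_fin.
rewrite (@ge0_integral_image _ _ _ tau mu _ _ fst_borel mf f0'); last first.
  by move=> A mA; have [] := ctau A mA.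
rewrite (@ge0_integral_image _ _ _ tau nu _ _ snd_borel mf f0'); last first.
  by move=> A mA; have [] := ctau A mA.
have mf1 : measurable_fun setT (fun z : borel TE => (f z.1)%:E).
  exact: (measurableT_comp mf fst_borel).
have mf2 : measurable_fun setT (fun z : borel TE => (f z.2)%:E).
  exact: (measurableT_comp mf snd_borel).
have d0 (z : TE) : (0 <= (enorm (z.1 - z.2))%:E)%E by rewrite lee_fin enorm_ge0.
have md := dist_measurable1.
have kd : (k%:E * cost tau)%E = (\int[tau]_z (k * enorm (z.1 - z.2))%:E)%E.
  by rewrite /cost -ge0_integralZl//; apply: eq_integral => z _; rewrite EFinM.
have kd0 (z : TE) : (0 <= (k * enorm (z.1 - z.2))%:E)%E.
  by rewrite lee_fin mulr_ge0// enorm_ge0.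
have mkd := dist_measurable k.
rewrite kd; split.
  rewrite -ge0_integralD//; apply: ge0_le_integral => //.
    by apply: emeasurable_funD.
  by move=> z _; rewrite -EFinD lee_fin fk.
rewrite -ge0_integralD//; apply: ge0_le_integral => //.
  by apply: emeasurable_funD.
by move=> z _; rewrite -EFinD lee_fin enormB fk.
Qed.

Lemma W_lipschitz mu nu (w : R) (f : E -> R) (k : R) :
  (W mu nu <= w%:E)%E -> 0 <= k -> (forall x, 0 <= f x) ->
  (forall x y, f x <= f y + k * enorm (x - y)) ->
  (\int[mu]_x (f x)%:E <= \int[nu]_x (f x)%:E + (k * w)%:E)%E /\
  (\int[nu]_x (f x)%:E <= \int[mu]_x (f x)%:E + (k * w)%:E)%E.
Proof.
move=> Ww k0 f0 fk.
have H e : 0 < e -> (\int[mu]_x (f x)%:E <= \int[nu]_x (f x)%:E + (k * w + e)%:E)%E /\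
    (\int[nu]_x (f x)%:E <= \int[mu]_x (f x)%:E + (k * w + e)%:E)%E.
  move=> e0.
  have k1 : 0 < k + 1 by rewrite ltr_wpDl.
  (* The infimum defining W need not be attained, so a coupling of cost below w + e / (k + 1) is
     taken. Dividing by k + 1 rather than k allows k = 0. *)
  have ek : 0 < e / (k + 1) by rewrite divr_gt0.
  have : (W mu nu < (w + e / (k + 1))%:E)%E.
    by rewrite (le_lt_trans Ww)// lte_fin ltrDl.
  move=> /W_lt[tau ctau /ltW tauw].
  have kc : (k%:E * cost tau <= (k * w + e)%:E)%E.
    rewrite (@le_trans _ _ (k%:E * (w + e / (k + 1))%:E)%E)//.
      by rewrite lee_wpmul2l// lee_fin.
    rewrite -EFinM lee_fin mulrDr lerD2l mulrA ler_pdivrMr//.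
    by rewrite mulrC ler_wpM2l ?(ltW e0)// lerDl.
  have [H1 H2] := coupling_lipschitz ctau k0 f0 fk.
  by split; [rewrite (le_trans H1)// leeD2l|rewrite (le_trans H2)// leeD2l].
split; apply/lee_addgt0Pr => e /H[H1 H2]; by rewrite -addeA -EFinD.
Qed.

End Wasserstein.

(** * Truncation of a measure to a ball *)

Section Truncation.
Context {R : realType} {n : nat}.
Local Notation E := 'rV[R]_n.
Local Notation TE := ('rV[R]_n * 'rV[R]_n)%type.
Implicit Types (mu nu a g : Prob R E) (x y : E).

(** For r > 0, the projection onto the closed ball of radius r. The maximum merges the two cases
    into one formula, from which continuity is immediate. *)
Definition radial_proj (r : R) x : E := (r / Num.max r (enorm x)) *: x.

Section fixed_radius.
Variable r : R.
Hypothesis r0 : 0 < r.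

Let max_gt0 x : 0 < Num.max r (enorm x). Proof. by rewrite lt_max r0. Qed.

Lemma radial_proj_id x : enorm x <= r -> radial_proj r x = x.
Proof. by move=> xr; rewrite /radial_proj max_l// divff ?gt_eqF// scale1r. Qed.

Lemma enorm_radial_proj x : enorm (radial_proj r x) <= r.
Proof.
rewrite enormZ ger0_norm ?divr_ge0 ?(ltW r0) ?(ltW (max_gt0 x))//.
by rewrite mulrAC ler_pdivrMr// ler_pM2l// le_max lexx orbT.
Qed.

(** The projection moves an outside point y by |y| - r <= |y| - |x| <= |x - y|; the triangle
    inequality through y then gives the factor 2. *)
Lemma radial_proj_dist x y : enorm x <= r ->
  enorm (x - radial_proj r y) <= 2 * enorm (x - y).
Proof.
move=> xr; have [yr|yr] := leP (enorm y) r.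
  by rewrite radial_proj_id// ler_peMl ?enorm_ge0// ler1n.
have yp : enorm (y - radial_proj r y) <= enorm y - r.
  rewrite /radial_proj max_r ?(ltW yr)// -{1}(scale1r y) -scalerBl enormZ.
  have y0 : 0 < enorm y by exact: lt_trans yr.
  rewrite ger0_norm; last by rewrite subr_ge0 ler_pdivrMr// mul1r ltW.
  by rewrite mulrBl mul1r divfK// gt_eqF.
have xy : enorm y <= enorm x + enorm (x - y).
  by rewrite (enormB x) (le_trans _ (enormD _ _))// addrC subrK.
rewrite (le_trans (enorm_distD y _ _))//; lra.
Qed.

Lemma radial_proj_continuous : continuous (radial_proj r).
Proof.
move=> x; apply: (@continuousZ _ _ _ (fun x => r / Num.max r (enorm x)) id);
  last exact: cvg_id.
apply: continuousM; first exact: cst_continuous.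
apply: continuousV; first by rewrite gt_eqF.
apply: continuous_max; [exact: cst_continuous|exact: enorm_continuous].
Qed.

End fixed_radius.

Lemma supp_sub (F : set E) mu : closed F -> mu (~` F) = 0%E -> supp mu `<=` F.
Proof.
move=> cF mF x sx; apply: contrapT => Fx.
by have := sx (~` F); rewrite mF ltxx openC => /(_ cF Fx).
Qed.

Lemma eball_Pc mu r : supp mu `<=` eball r -> Pc mu.
Proof.
move=> sr; apply: (@bounded_closed_compact_enorm _ _ _ r); first exact: supp_closed.
by move=> x /sr/ltW.
Qed.

(** Take for b the image of g under the radial projection. The same b serves every a, so two
    measures close to g can both be compared with it, and g itself may have any support. *)
Lemma truncation g r : 0 < r -> exists b : Prob R E,
  supp b `<=` eball (r + 1) /\
  forall a w, supp a `<=` eball r -> (W a g <= w%:E)%E -> (W a b <= (2 * w)%:E)%E.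
Proof.
move=> r0; pose P := radial_proj r.
have mP : measurable_fun setT (P : borel E -> borel E).
  by apply: continuous_borel_measurable; exact: radial_proj_continuous.
have [b bE] := image_prob g mP.
exists b; split.
  (* The projection may reach the sphere of radius r, so b is only known to live in the closed ball;
     the open ball of radius r + 1 contains it. *)
  apply: (@subset_trans _ [set x | enorm x <= r]); last first.
    by move=> x /= xr; rewrite /eball /= (le_lt_trans xr)// ltrDl.
  apply: supp_sub.
    apply: (@preimage_closed _ _ (@enorm R n) [set y | y <= r]).
      by move=> x _; exact: enorm_continuous.
    exact: closed_le.
  rewrite bE (_ : _ @^-1` _ = set0) ?measure0//.
  by apply/seteqP; split => // x; apply; exact: enorm_radial_proj.
move=> a w ar agw; apply/lee_addgt0Pr => e e0.
have : (W a g < (w + e / 2)%:E)%E by rewrite (le_lt_trans agw)// lte_fin ltrDl divr_gt0.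
move=> /W_lt[tau ctau /ltW tauw].
(* Projecting the second coordinate turns a coupling of a and g into a coupling of a and b. *)
have mP2 : measurable_fun setT
    ((fun z : TE => (z.1, P z.2)) : borel TE -> borel TE).
  apply: continuous_borel_measurable => z.
  apply: (@cvg_pair _ _ _ _ _ _ (nbhs_filter z) (nbhs_filter z.1) (nbhs_filter (P z.2))).
    exact: cvg_fst.
  apply: (@continuous_comp _ _ _ snd); first exact: cvg_snd.
  exact: radial_proj_continuous.
have [tau' tauE] := image_prob tau mP2.
have ctau' : coupling a b tau'.
  move=> A mA; rewrite /pushforward !tauE; split.
    by have [<- _] := ctau A mA.
  have mPA : measurable (P @^-1` A : set (borel E)).
    by rewrite -[X in measurable X]setTI; exact: mP.
  by rewrite bE; have [_ <-] := ctau _ mPA.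
apply: (@le_trans _ _ (cost tau')).
  by apply: ereal_inf_lbound; exists tau'.
rewrite /cost (@ge0_integral_image _ _ _ tau tau' _ _ mP2)//; last first.
- by move=> y; rewrite lee_fin enorm_ge0.
- exact: dist_measurable1.
apply: (@le_trans _ _ (\int[tau]_z (2 * enorm (z.1 - z.2))%:E)%E); last first.
  under eq_integral do rewrite EFinM.
  rewrite ge0_integralZl//; last first.
    by move=> z _; rewrite lee_fin enorm_ge0.
    exact: dist_measurable1.
  rewrite (@le_trans _ _ (2%:E * (w + e / 2)%:E)%E)// ?lee_wpmul2l//.
  by rewrite -EFinM -EFinD lee_fin mulrDr lerD2l mulrC divfK.
apply: ae_ge0_le_integral => //.
- by move=> z _; rewrite lee_fin enorm_ge0.
- exact: (measurableT_comp dist_measurable1 mP2).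
- by move=> z _; rewrite lee_fin mulr_ge0// enorm_ge0.
- exact: dist_measurable.
(* The distance bound needs the first coordinate in the ball of radius r. This can fail only where
   that coordinate leaves [supp a], a null set for the coupling. *)
exists (fst @^-1` (~` supp a)); split.
- rewrite -[X in measurable X]setTI; apply: fst_borel => //.
  by apply: open_borel; rewrite openC; exact: supp_closed.
- have [] := ctau (~` supp a); last by move=> H _; rewrite -(null_supp_setC a) -H.
  by apply: open_borel; rewrite openC; exact: supp_closed.
- move=> z /= zP sz; apply: zP => _.
  by rewrite lee_fin radial_proj_dist//; have /ltW := ar _ sz.
Qed.

End Truncation.

(** * Approximation by finitely supported measures *)

Section Discretization.
Context {R : realType} {n : nat}.
Local Notation E := 'rV[R]_n.
Local Notation TE := ('rV[R]_n * 'rV[R]_n)%type.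
Implicit Types (mu nu : Prob R E) (x y : E) (s : seq E).

Lemma open_enorm_ball y (d : R) : open [set x | enorm (x - y) < d].
Proof.
have : continuous (fun x : E => enorm (x - y)).
  move=> x; apply: (@continuous_comp _ _ _ (fun x : E => x - y)).
    by apply: continuousB; [exact: cvg_id|exact: cst_continuous].
  exact: enorm_continuous.
by move/continuousP => /(_ [set z | z < d]); apply; exact: open_lt.
Qed.

Lemma closed_point y : closed [set y].
Proof. exact/accessible_closed_set1/hausdorff_accessible/norm_hausdorff. Qed.

Lemma closed_seq s : closed [set` s].
Proof.
elim: s => [|y s IHs]; first by rewrite classical_sets.set_nil; exact: closed0.
rewrite (_ : [set` y :: s] = [set y] `|` [set` s]); last first.
  by apply/seteqP; split=> z /=; rewrite inE; [move/predU1P|move=> [->|->]; rewrite ?eqxx ?orbT].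
by apply: closedU => //; exact: closed_point.
Qed.

(** The atoms are the points of s without repetition, and those of zero mass are filtered out
    because the weights must be strictly positive. *)
Lemma finitely_supported_discrete mu s : mu (~` [set` s]) = 0%E -> discrete_prob mu.
Proof.
move=> mus; pose t := [seq y <- undup s | 0 < mu [set y]]%E.
have m1 y : measurable ([set y] : set (borel E)) by apply: closed_borel; exact: closed_point.
have ms : measurable ([set` s] : set (borel E)) by apply: closed_borel; exact: closed_seq.
have fin1 y : mu [set y] \is a fin_num by exact: fin_num_measure.
have mu_le (A B : set (borel E)) :
    measurable A -> measurable B -> A `<=` B -> (mu A <= mu B)%E.
  by move=> mA mB; apply: le_measure; exact: mem_set.
have muE A : measurable (A : set (borel E)) ->
    mu A = (\sum_(y <- t) (fine (mu [set y]))%:E * \d_(y : borel E) A)%E.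
  move=> mA.
  have -> : mu A = mu (A `&` [set` s]).
    apply/eqP; rewrite eq_le; apply/andP; split; last first.
      by apply: mu_le => //; exact: measurableI.
    rewrite -[X in mu X](setUIDK A [set` s]).
    rewrite (le_trans (measureU2 _ _ _))//; [exact: measurableI|exact: measurableD|].
    rewrite [X in (_ + X)%E](_ : _ = 0%E) ?adde0//.
    apply/eqP; rewrite eq_le measure_ge0 andbT -mus.
    by apply: mu_le; [exact: measurableD|exact: measurableC|exact: subIsetr].
  have -> : A `&` [set` s] = \bigcup_(y in [set` undup s]) (A `&` [set y]).
    apply/seteqP; split=> [y [Ay ys]|y [z /= + [Ay yz]]].
      by exists y => //=; rewrite mem_undup.
    by rewrite -yz mem_undup; split.
  rewrite measure_fin_bigcup//; last 3 first.
  - exact: finite_seq.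
  - by move=> y z _ _ [w [[_ ->] [_ ->]]].
  - by move=> y _; exact: measurableI.
  rewrite -fsbig_seq ?undup_uniq// big_filter [RHS]big_mkcond /=.
  apply: eq_bigr => y _.
  have muAy : mu (A `&` [set y]) = (mu [set y] * \d_(y : borel E) A)%E.
    rewrite diracE; have [Ay|Ay] := pselect (A y).
      rewrite mem_set// mule1; congr (mu _); apply/seteqP; split=> [z []//|z ->//].
    rewrite memNset// mule0 (_ : _ `&` _ = set0) ?measure0//.
    by apply/seteqP; split => // z [Az zy]; apply: Ay; rewrite -zy.
  rewrite muAy fineK//; case: ifPn => //; rewrite -leNgt => my.
  suff -> : mu [set y] = 0%E by rewrite mul0e.
  by apply/eqP; rewrite eq_le my measure_ge0.
pose x (i : 'I_(size t)) : borel E := nth 0 t i.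
have big_t (B : set (borel E)) : (\sum_(y <- t) (fine (mu [set y]))%:E * \d_(y : borel E) B =
    \sum_(i < size t) (fine (mu [set x i]))%:E * \d_(x i) B)%E.
  by rewrite (big_nth 0) big_mkord.
exists (size t); exists (fun i => fine (mu [set x i])); exists x; split.
- move=> i; rewrite fine_gt0//.
  have : x i \in t by exact: mem_nth.
  rewrite mem_filter => /andP[-> _] /=.
  by have := fin1 (x i); rewrite ge0_fin_numE.
- apply: EFin_inj; rewrite -sumEFin -(probability_setT mu) muE// big_t.
  by apply: eq_bigr => i _; rewrite diracT mule1.
- by move=> A mA; rewrite muE.
Qed.

(** A quantization map: x goes to the first centre of s at distance less than d, and to the default
    x0 when there is none. *)
Fixpoint first_near (d : R) (x0 : E) s x : E :=
  if s is y :: s' then if enorm (x - y) < d then y else first_near d x0 s' x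
  else x0.

Lemma first_near_in d x0 s x : first_near d x0 s x \in x0 :: s.
Proof.
elim: s => [|y s IHs] /=; first exact: mem_head.
case: ifP => _; first by rewrite !inE eqxx orbT.
by move: IHs; rewrite !inE => /orP[->//|->]; rewrite !orbT.
Qed.

Lemma first_near_dist d x0 s x :
  (exists2 y, y \in s & enorm (x - y) < d) -> enorm (x - first_near d x0 s x) < d.
Proof.
elim: s => [|y s IHs] [z] //=; case: ifP => // yd.
rewrite inE => /orP[/eqP->|zs zd]; first by rewrite yd.
by apply: IHs; exists z.
Qed.

(** [borel TE] is generated by the open sets V of the product, so preimages of such V are examined.
    On each piece the map is x |-> (x, y) with y fixed, which is continuous, and the pieces are cut
    out by open balls and their complements. *)
Lemma first_near_graph_measurable d x0 s :
  measurable_fun setT ((fun x => (x, first_near d x0 s x)) : borel E -> borel TE).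
Proof.
have pairc y : continuous (fun x : E => (x, y)).
  move=> x.
  apply: (@cvg_pair _ _ _ _ _ _ (nbhs_filter x) (nbhs_filter x) (nbhs_filter y)).
    exact: cvg_id.
  exact: cvg_cst.
apply: borel_measurable_fun => V oV.
have openV y : open [set x | V (x, y)] 
  by have /continuousP cy := pairc y; exact: (cy _ oV).
elim: s => [|y s IHs] /=; first by apply: open_borel; exact: openV.
have mB : measurable ([set x | enorm (x - y) < d] : set (borel E)).
  by apply: open_borel; exact: open_enorm_ball.
rewrite (_ : _ @^-1` _ =
  ([set x | enorm (x - y) < d] `&` [set x | V (x, y)]) `|`
  (~` [set x | enorm (x - y) < d] `&` [set x | V (x, first_near d x0 s x)])).
  apply: measurableU; first by apply: measurableI => //; apply: open_borel; exact: openV.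
  by apply: measurableI => //; exact: measurableC.
apply/seteqP; split=> x /=; case: ifPn => xy.
- by move=> ?; left.
- by move=> ?; right; split => //; exact/negP.
- by move=> [[]//|[]].
- by move=> [[]|[]].
Qed.

(** Cover the support by finitely many balls of radius d centred in it and send each point to the
    first near centre. The image of nu under the graph of this map is a coupling of cost at most
    d. *)
Lemma discretization nu (r d : R) : compact (supp nu) -> supp nu `<=` eball r ->
  0 < d -> exists2 nu', discrete_prob_in r nu' & (W nu nu' <= d%:E)%E.
Proof.
move=> cnu nur d0.
(* The default x0 must also lie in the support, so that the discrete measure stays in the ball of
   radius r. An empty support would make the whole space null. *)
have [x0 sx0] : supp nu !=set0.
  apply/set0P/negP => /eqP s0; have := null_supp_setC nu.
  by rewrite s0 setC0 probability_setT => /eqP; rewrite onee_eq0.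
have := cnu; rewrite compact_cover => /(_ _ (supp nu) (fun y => [set x | enorm (x - y) < d])) [].
- by move=> y _; exact: open_enorm_ball.
- by move=> x sx; exists x => //=; rewrite subrr enorm0.
move=> D Dsupp Dcover; pose s : seq E := D; pose q := first_near d x0 s.
have mg : measurable_fun setT ((fun x => (x, q x)) : borel E -> borel TE).
  exact: first_near_graph_measurable.
have mq : measurable_fun setT (q : borel E -> borel E).
  exact: (measurableT_comp snd_borel mg).
have [nu' nu'E] := image_prob nu mq.
have [tau tauE] := image_prob nu mg.
have s_supp : [set` x0 :: s] `<=` supp nu.
  by move=> y /=; rewrite inE => /orP[/eqP->//|/Dsupp/set_mem].
have nu's : nu' (~` [set` x0 :: s]) = 0%E.
  rewrite nu'E (_ : _ @^-1` _ = set0) ?measure0//.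
  by apply/seteqP; split => // x; apply; exact: first_near_in.
exists nu'.
  split; first exact: finitely_supported_discrete nu's.
  apply: subset_trans nur; apply: subset_trans s_supp.
  by apply: supp_sub => //; exact: closed_seq.
apply: (@le_trans _ _ (cost tau)).
  by apply: ereal_inf_lbound; exists tau => // A mA; rewrite /pushforward !tauE nu'E.
rewrite /cost (@ge0_integral_image _ _ _ nu tau _ _ mg)//; last first.
- by move=> y; rewrite lee_fin enorm_ge0.
- exact: dist_measurable1.
apply: (@le_trans _ _ (\int[nu]_z d%:E)%E); last first.
  by rewrite integral_cst//= probability_setT mule1.
apply: ae_ge0_le_integral => //.
- by move=> z _; rewrite lee_fin enorm_ge0.
- exact: (measurableT_comp dist_measurable1 mg).
- by move=> z _; rewrite lee_fin ltW.
exists (~` supp nu); split.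
- by apply: open_borel; rewrite openC; exact: supp_closed.
- exact: null_supp_setC.
- move=> x /= xP sx; apply: xP => _.
  rewrite lee_fin ltW// first_near_dist//.
  by have [y yD xy] := Dcover _ sx; exists y.
Qed.

End Discretization.

(** * Closeness of the integrals of a fixed function *)

Section IntegralCloseness.
Context {R : realType} {n : nat}.
Local Notation E := 'rV[R]_n.
Variable f : E -> R.
Implicit Types (a b c : Prob R E) (w : R).

(** This stands for |I(a) - I(b)| <= w, written without subtraction because the integrals are
    extended reals. *)
Definition close w a b : Prop :=
  (\int[a]_x (f x)%:E <= \int[b]_x (f x)%:E + w%:E)%E /\
  (\int[b]_x (f x)%:E <= \int[a]_x (f x)%:E + w%:E)%E.

Lemma closeC w a b : close w a b -> close w b a.
Proof. by case. Qed.

Lemma close_trans w w' a b c : close w a b -> close w' b c -> close (w + w') a c.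
Proof.
move=> [ab ba] [bc cb]; rewrite /close EFinD; split.
  by rewrite (le_trans ab)// addeA addeAC leeD2r.
by rewrite (le_trans cb)// addeA leeD2r.
Qed.

Lemma measure_eq_close a b : a ≡μ b -> close 0 a b.
Proof.
move=> ab; rewrite /close adde0 (eq_measure_integral b)//; last first.
  by move=> A mA _; exact: ab.
by rewrite adde0 lexx.
Qed.

Lemma close_le w w' a b : w <= w' -> close w a b -> close w' a b.
Proof.
move=> ww [ab ba]; split; [apply: le_trans ab _|apply: le_trans ba _];
  by rewrite leeD2l// lee_fin.
Qed.

Lemma close_extl w a b c : a ≡μ b -> close w b c -> close w a c.
Proof. by move=> /measure_eq_close ab bc; have := close_trans ab bc; rewrite add0r. Qed.

Lemma close_extr w a b c : close w a b -> b ≡μ c -> close w a c.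
Proof. by move=> ab /measure_eq_close bc; have := close_trans ab bc; rewrite addr0. Qed.

End IntegralCloseness.

(** * Comparison of two semigroups compatible with the same germ *)

Section Semigroups.
Context {R : realType} {n : nat}.
Local Notation E := 'rV[R]_n.
Variables (V : Prob R E -> Prob R (E * E)%type) (C T : R).
Hypotheses (C0 : 0 < C) (T0 : 0 < T).
Implicit Types (S : R -> Prob R E -> Prob R E) (mu nu a b : Prob R E) (r t : R).

(** The support bound of the semigroup at the final time T: a radius valid at all times for measures
    starting in the ball of radius r. *)
Definition grow r : R := expR (C * T) * (r + 1).

Lemma lt_grow r : 0 < r -> r < grow r.
Proof.
move=> r0; rewrite (@lt_le_trans _ _ (r + 1)) ?ltrDl// ler_peMl ?addr_ge0 ?ltW//.
by rewrite -expR0 ltr_expR mulr_gt0.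
Qed.

Lemma eball_subset r r' : r <= r' -> @eball R n r `<=` eball r'.
Proof. by move=> rr x; rewrite /eball /= => /lt_le_trans; exact. Qed.

Lemma semigroup_supp S r t mu : lipschitz_semigroup V C T S -> 0 < r ->
  0 <= t <= T -> supp mu `<=` eball r -> supp (S t mu) `<=` eball (grow r).
Proof.
move=> hS r0 t0T mur; have [Cr _ SP] := sg_lip hS r0.
have Pmu := eball_Pc mur.
have [+ _ _] := SP mu mu Pmu Pmu mur mur t t t0T t0T.
move=> /subset_trans; apply; apply: eball_subset.
rewrite ler_wpM2r ?addr_ge0 ?(ltW r0)// ler_expR ler_wpM2l ?(ltW C0)//.
by case/andP: t0T.
Qed.

Lemma semigroup_lipschitz S r : lipschitz_semigroup V C T S -> 0 < r ->
  exists2 M : R, 0 < M & forall t mu nu (w : R), 0 <= t <= T ->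
    supp mu `<=` eball r -> supp nu `<=` eball r ->
    0 <= w -> (W mu nu <= w%:E)%E -> (W (S t mu) (S t nu) <= (M * w)%:E)%E.
Proof.
move=> hS r0; have [Cr Cr0 SP] := sg_lip hS r0.
exists (expR (Cr * T)) => [|t mu nu w t0T mur nur w0 Ww]; first exact: expR_gt0.
have [_ + _] := SP mu nu (eball_Pc mur) (eball_Pc nur) mur nur t t t0T t0T.
move=> /le_trans; apply; rewrite EFinM.
apply: (@le_trans _ _ ((expR (Cr * t))%:E * w%:E)%E).
  by rewrite lee_wpmul2l// lee_fin expR_ge0.
rewrite -!EFinM lee_fin ler_wpM2r// ler_expR ler_wpM2l ?(ltW Cr0)//.
by case/andP: t0T.
Qed.

Variables (eps : Prob R E -> R) (gamma : Prob R E -> R -> Prob R E).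
Variables S1 S2 : R -> Prob R E -> Prob R E.
Hypotheses (hS1 : lipschitz_semigroup V C T S1) (hS2 : lipschitz_semigroup V C T S2).
Hypotheses (hc1 : compatible T S1 eps gamma) (hc2 : compatible T S2 eps gamma).

(* The support of gamma is not controlled uniformly, so the germ enters only
   through its truncation to a ball containing the supports of S1 and S2. *)
Lemma semigroup_step (f : E -> R) (k r : R) : 0 <= k -> 0 < r ->
  (forall x, 0 <= f x) -> (forall x y, f x <= f y + k * enorm (x - y)) ->
  exists2 K : R, 0 < K & forall (s h : R) nu, 0 <= s -> 0 < h -> s + h <= T ->
    h <= inf [set eps mu | mu in discrete_prob_in r] -> supp nu `<=` eball r ->
    close f (K * h ^+ 2) (S1 s (S1 h nu)) (S1 s (S2 h nu)).
Proof.
move=> k0 r0 f0 fk.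
have r1 : 0 < grow r by exact: lt_trans (lt_grow r0).
have r2 : 0 < grow r + 1 by exact: addr_gt0.
(* The Lipschitz constants are taken on the ball of radius [grow r + 1], which contains the initial
   measures, their evolutions up to T and the truncated germ. *)
have [M1 M10 L1] := semigroup_lipschitz hS1 r2.
have [M2 M20 L2] := semigroup_lipschitz hS2 r2.
have [C1 C10 G1] := hc1 r0.
have [C2 C20 G2] := hc2 r0.
(* One summand for each of the four links [A1], [A2], [A3], [A4] below; the final 1 keeps the
   constant positive when k = 0. *)
exists (k * (M1 * M1) + k * (M1 * (2 * C1)) + k * (M1 * (2 * C2)) + k * (M1 * M2) + 1).
  by rewrite ltr_wpDl// !addr_ge0// mulr_ge0// ltW// !mulr_gt0.
move=> s h nu s0 h0 shT hinf nur.
have sT : 0 <= s <= T by rewrite s0/= (le_trans _ shT)// lerDl ltW.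
have hT : 0 <= h <= T by rewrite (ltW h0)/= (le_trans _ shT)// lerDr.
have hT' : h <= T by rewrite (le_trans _ shT)// lerDr.
have hinf' : 0 <= h <= inf [set eps mu | mu in discrete_prob_in r] by rewrite ltW.
have h20 : 0 < h ^+ 2 by rewrite exprn_gt0.
(* The precision h^2 matches the order of the compatibility estimate. *)
have [nu' [dnu' nu'r] Wnu] := discretization (eball_Pc nur) nur h20.
have ge S (c : R) : (ereal_sup [set W (S h mu) (gamma mu h) | mu in discrete_prob_in r] <=
       (c * h ^+ 2)%:E)%E -> (W (S h nu') (gamma nu' h) <= (c * h ^+ 2)%:E)%E.
  by apply: le_trans; apply: ereal_sup_ubound; exists nu'.
have {}G1 : (W (S1 h nu') (gamma nu' h) <= (C1 * h ^+ 2)%:E)%E.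
  exact: ge (G1 _ hinf' hT').
have {}G2 : (W (S2 h nu') (gamma nu' h) <= (C2 * h ^+ 2)%:E)%E.
  exact: ge (G2 _ hinf' hT').
have [b [br bW]] := truncation (gamma nu' h) r1.
have sub r' : r' <= grow r -> @eball R n r' `<=` eball (grow r + 1).
  by move=> rr; apply: eball_subset; rewrite (le_trans rr)// lerDl.
have subr := sub _ (ltW (lt_grow r0)).
have subg := sub _ (lexx _).
have step (a a' : Prob R E) (w : R) : supp a `<=` eball (grow r + 1) ->
    supp a' `<=` eball (grow r + 1) -> 0 <= w -> (W a a' <= w%:E)%E ->
    close f (k * (M1 * w)) (S1 s a) (S1 s a').
  by move=> ar ar' w0 aw; apply: W_lipschitz => //; exact: L1.
have supp1 := semigroup_supp hS1 r0 hT.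
have supp2 := semigroup_supp hS2 r0 hT.
have A1 : close f (k * (M1 * (M1 * h ^+ 2))) (S1 s (S1 h nu)) (S1 s (S1 h nu')).
  apply: step; [exact: subset_trans (supp1 _ nur) subg|exact: subset_trans (supp1 _ nu'r) subg| |].
    by rewrite ltW// mulr_gt0.
  by apply: L1 => //; [exact: subset_trans nur subr|exact: subset_trans nu'r subr|exact: ltW].
have A2 : close f (k * (M1 * (2 * (C1 * h ^+ 2)))) (S1 s (S1 h nu')) (S1 s b).
  apply: step; [exact: subset_trans (supp1 _ nu'r) subg|exact: br| |].
    by rewrite ltW// !mulr_gt0.
  by apply: bW => //; exact: supp1.
have A3 : close f (k * (M1 * (2 * (C2 * h ^+ 2)))) (S1 s (S2 h nu')) (S1 s b).
  apply: step; [exact: subset_trans (supp2 _ nu'r) subg|exact: br| |].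
    by rewrite ltW// !mulr_gt0.
  by apply: bW => //; exact: supp2.
have A4 : close f (k * (M1 * (M2 * h ^+ 2))) (S1 s (S2 h nu)) (S1 s (S2 h nu')).
  apply: step; [exact: subset_trans (supp2 _ nur) subg|exact: subset_trans (supp2 _ nu'r) subg| |].
    by rewrite ltW// mulr_gt0.
  by apply: L2 => //; [exact: subset_trans nur subr|exact: subset_trans nu'r subr|exact: ltW].
(* The chain runs from S1_h nu to S1_h nu', to b, to S2_h nu', to S2_h nu, each followed by S1_s. *)
have := close_trans (close_trans (close_trans A1 A2) (closeC A3)) (closeC A4).
apply: close_le; lra.
Qed.

Lemma semigroup_integral_unique (f : E -> R) (k t : R) mu : 0 <= k ->
  (forall r, 0 < r -> 0 < inf [set eps mu | mu in discrete_prob_in r]) ->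
  (forall x, 0 <= f x) -> (forall x y, f x <= f y + k * enorm (x - y)) ->
  0 <= t <= T -> Pc mu ->
  (\int[S1 t mu]_x (f x)%:E = \int[S2 t mu]_x (f x)%:E)%E.
Proof.
move=> k0 inf0 f0 fk t0T Pmu; have [t0 tT] := andP t0T.
have Pc2 s nu : 0 <= s <= T -> Pc nu -> Pc (S2 s nu) by exact: (sg_Pc hS2).
have [r r0 mur] := compact_enorm_bounded Pmu.
have r1 : 0 < grow r by exact: lt_trans (lt_grow r0).
(* The radius [grow r] covers all the measures S2_(jh) mu, so one constant K and one threshold d
   serve every link. *)
have [K K0 step] := semigroup_step k0 r1 f0 fk.
set d := inf _ in step; have d0 : 0 < d by exact: inf0.
have H0 : S1 0 mu ≡μ S2 0 mu.
  by move=> A mA; rewrite (sg_0 hS1 Pmu mA) (sg_0 hS2 Pmu mA).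
have close0 : forall e, 0 < e -> close f e (S1 t mu) (S2 t mu).
  (* The case t = 0 is separate, since the subdivision needs a step h > 0. *)
  move=> e e0; move: t0; rewrite le_eqVlt => /predU1P[t00|t0].
    by rewrite -t00; apply: (close_le (ltW e0)); exact: measure_eq_close H0.
  (* N exceeds t / d, so that h = t / N <= d, and also K t^2 / e, so that the total error N K h^2 =
     K t^2 / N is at most e. *)
  pose N := (Num.bound (t / d + K * t ^+ 2 / e)).+1.
  have N0 : 0 < N%:R :> R by rewrite ltr0n.
  have td0 : 0 <= t / d by rewrite ltW// divr_gt0.
  have Ke0 : 0 <= K * t ^+ 2 / e by rewrite ltW// divr_gt0// mulr_gt0// exprn_gt0.
  have NB : t / d + K * t ^+ 2 / e < N%:R.
    by rewrite (lt_trans (archi_boundP (addr_ge0 td0 Ke0)))// ltr_nat.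
  pose h := t / N%:R; have h0 : 0 < h by rewrite divr_gt0.
  have Nh : N%:R * h = t by rewrite /h mulrC divfK// gt_eqF.
  have hd : h <= d.
    rewrite ler_pdivrMr// mulrC -ler_pdivrMr// ltW// (le_lt_trans _ NB)//.
    by rewrite lerDl.
  have NK : N%:R * (K * h ^+ 2) <= e.
    have -> : N%:R * (K * h ^+ 2) = K * t ^+ 2 / N%:R.
      by rewrite -Nh; field; rewrite gt_eqF.
    by rewrite ler_pdivrMr// [leRHS]mulrC -ler_pdivrMr// ltW// (le_lt_trans _ NB)// lerDr.
  have jh j : (j <= N)%N -> 0 <= j%:R * h <= t.
    by move=> jN; rewrite mulr_ge0 ?(ltW h0)//= -Nh ler_wpM2r ?(ltW h0)// ler_nat.
  (* S2 is run for the first j steps and S1 for the remaining time; each increment of j replaces one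
     step of S1 by one of S2 and costs K h^2. *)
  have tele j : (j <= N)%N ->
      close f (j%:R * (K * h ^+ 2)) (S1 t mu) (S1 (t - j%:R * h) (S2 (j%:R * h) mu)).
    elim: j => [_|j IHj jN].
      rewrite !mul0r subr0; apply: measure_eq_close.
      apply: (sg_ext hS1) => //; first by apply: Pc2; rewrite ?lexx ?ltW.
      by move=> A mA; rewrite (sg_0 hS2 Pmu mA).
    have /andP[jh0 jht] := jh _ (ltnW jN); have /andP[jh1 jht1] := jh _ jN.
    have jE : j.+1%:R * h = h + j%:R * h by rewrite -natr1 mulrDl mul1r addrC.
    set nu := S2 (j%:R * h) mu in IHj *.
    have jT : 0 <= j%:R * h <= T by rewrite jh0 (le_trans jht).
    have hT : 0 <= h <= T.
      by rewrite ltW//= (le_trans _ tT)// (le_trans _ jht1)// jE lerDl.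
    have Pnu : Pc nu by exact: Pc2.
    set s := t - j.+1%:R * h.
    have sh : s + h = t - j%:R * h by rewrite /s jE; ring.
    have s0 : 0 <= s by rewrite subr_ge0.
    have shT : s + h <= T by rewrite sh (le_trans _ tT)// lerBlDr lerDl.
    have sT : 0 <= s <= T by rewrite s0 (le_trans _ shT)// lerDl ltW.
    have nur : supp nu `<=` eball (grow r) by exact: semigroup_supp.
    have -> : j.+1%:R * (K * h ^+ 2) = j%:R * (K * h ^+ 2) + K * h ^+ 2.
      by rewrite -natr1 mulrDl mul1r.
    apply: (close_trans (IHj (ltnW jN))); rewrite -sh.
    (* Split S1_(s + h) nu as S1_s (S1_h nu), exchange S1_h for S2_h, then absorb S2_h into
       S2_((j+1)h) mu under S1_s, which respects equality of measures. *)
    apply: close_extl; first by move=> A mA; rewrite -(sg_D hS1 sT hT shT Pnu mA).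
    apply: (close_extr (step s h nu s0 h0 shT hd nur)).
    apply: (sg_ext hS1) => //; [exact: Pc2|apply: Pc2 => //|].
      by rewrite jh1 (le_trans jht1).
    move=> A mA; rewrite jE; apply: (sg_D hS2) => //.
    by rewrite -jE (le_trans jht1).
  have := tele N (leqnn N); rewrite Nh subrr => teleN.
  apply: (close_le NK); apply: (close_extr teleN).
  by apply: (sg_0 hS1); exact: Pc2.
(* Two inequalities up to every e > 0 give equality in the extended reals, whether or not the
   integrals are finite. *)
apply/eqP; rewrite eq_le; apply/andP; split; apply/lee_addgt0Pr => e /close0[]//.
Qed.

End Semigroups.

Theorem theorem5p1 (R : realType) (n : nat)
    (V : Prob R 'rV[R]_n -> Prob R ('rV[R]_n * 'rV[R]_n)%type) (C T : R)
    (eps : Prob R 'rV[R]_n -> R)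
    (gamma : Prob R 'rV[R]_n -> R -> Prob R 'rV[R]_n)
    (hV : is_pvf V) (hC : 0 < C) (hVC : support_sublinear C V)
    (hT : 0 < T) (hgamma : dirac_germ V eps gamma)
    (S1 S2 : R -> Prob R 'rV[R]_n -> Prob R 'rV[R]_n)
    (hS1 : lipschitz_semigroup V C T S1) (hc1 : compatible T S1 eps gamma)
    (hS2 : lipschitz_semigroup V C T S2) (hc2 : compatible T S2 eps gamma) :
  forall (t : R) (mu : Prob R 'rV[R]_n), 0 <= t <= T -> Pc mu ->
    S1 t mu ≡μ S2 t mu.
Proof.
move=> t mu t0T Pmu; apply: eq_lipschitz_integral => f k k0 f0 fk.
exact: (semigroup_integral_unique hC hT hS1 hS2 hc1 hc2 k0 (germ_inf hgamma)
  f0 fk t0T Pmu).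
Qed.
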